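(* Let $\mathbb{Q}$ be a quantale and let $\mathbb{V} = (S,\mathcal{L},\to,\Downarrow)$ be a metric $\mathbb{Q}$-LTS, with its constants $\bot_{\mathbb V},\top_{\mathbb V}$ and operators $\bigwedge_{\mathbb V},\bigvee_{\mathbb V},+_{\mathbb V}$. Let $\le_{\mathbb V}$ be the largest $\le_{\mathbb Q}$-preserving simulation on $S$, and write $s \equiv_{\mathbb V} t$ when $s\le_{\mathbb V} t$ and $t\le_{\mathbb V} s$. Then: 1. $\le_{\mathbb V}$ is a preorder. 2. For all $s\in S$: $\bot_{\mathbb V}\le_{\mathbb V} s$ and $s\le_{\mathbb V}\top_{\mathbb V}$. 3. For all $S'\subseteq S$: $\bigwedge_{\mathbb V} S'$ is a lower bound of $S'$, and if $s'$ is a lower bound of $S'$ then $s'\le_{\mathbb V}\bigwedge_{\mathbb V} S'$. 4. For all $S'\subseteq S$: $\bigvee_{\mathbb V} S'$ is an upper bound of $S'$, and if $s'$ is an upper bound of $S'$ then $\bigvee_{\mathbb V} S'\le_{\mathbb V} s'$. 5. For all $s\in S$ and $S'\subseteq S$: $s +_{\mathbb V} \bigwedge_{\mathbb V} S' \equiv_{\mathbb V} \bigwedge_{\mathbb V}\{s+_{\mathbb V} s' \mid s'\in S'\}$. 6. For all $s\in S$: $s+_{\mathbb V}\bot_{\mathbb V}\equiv_{\mathbb V} s$. 7. For all $s,s'\in S$: $s+_{\mathbb V}s'\equiv_{\mathbb V}s'+_{\mathbb V}s$. 8. For all $s,s',s''\in S$: $(s+_{\mathbb V}s')+_{\mathbb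 V}s''\equiv_{\mathbb V}s'+_{\mathbb V}(s+_{\mathbb V}s'')$. 9. If $\le_{\mathbb V}$ is a partial order, then $\mathbb{V}$, i.e. $(S,\bigwedge_{\mathbb V},\bigvee_{\mathbb V},\bot_{\mathbb V},\top_{\mathbb V},+_{\mathbb V})$, is a quantale.
   Context: Quantale: a structure $\mathbb{Q}=(Q,\bigwedge,\bigvee,\bot,\top,+)$ such that $(Q,\bigwedge,\bigvee,\bot,\top)$ is a complete lattice ($\bigwedge,\bigvee:2^Q\to Q$ are meet and join, $\bot$ least, $\top$ greatest), $(Q,+,\bot)$ is a commutative monoid, and $e+\bigwedge A=\bigwedge\{e+f\mid f\in A\}$ for every $e\in Q$, $A\subseteq Q$. The order is $e\le f$ iff $e=\bigwedge\{e,f\}$. Pre-metric $\mathbb{Q}$-LTS: a quadruple $(S,\mathcal{L},\to,\Downarrow)$ with $S$ a set of states, $\mathcal{L}$ a set of labels, $\to\subseteq S\times\mathcal{L}\times S$ a transition relation, and $\Downarrow:S\to\mathbb{Q}$ a function. Metric $\mathbb{Q}$-LTS (MLTS): a pre-metric $\mathbb{Q}$-LTS $\mathbb{V}$ endowed with elements $\bot_{\mathbb V},\top_{\mathbb V}\in S$ and operators $\bigwedge_{\mathbb V},\bigvee_{\mathbb V}:2^S\to S$, $+_{\mathbb V}:S\times S\to S$ such that, for all $\ell\in\mathcal{L}$, $s,s',s_1,s_2\in S$, $S'\subseteq S$: (i) $\bot_{\mathbb V}\xrightarrow{\ell}s$ iff $s=\bot_{\mathbb V}$; $\Downarrow\bot_{\mathbb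 V}=\bot_{\mathbb Q}$; (ii) $\top_{\mathbb V}$ has no outgoing transitions; $\Downarrow\top_{\mathbb V}=\top_{\mathbb Q}$; (iii) $\bigwedge_{\mathbb V}S'\xrightarrow{\ell}s$ iff there is $s'\in S'$ with $s'\xrightarrow{\ell}s$; $\Downarrow\bigwedge_{\mathbb V}S'=\bigwedge_{\mathbb Q}\{\Downarrow s\mid s\in S'\}$; (iv) $\bigvee_{\mathbb V}S'\xrightarrow{\ell}s$ iff there is $S''\subseteq S$ with $s=\bigvee_{\mathbb V}S''$ and a surjective $f:S'\to S''$ such that $s'\xrightarrow{\ell}f(s')$ for all $s'\in S'$; $\Downarrow\bigvee_{\mathbb V}S'=\bigvee_{\mathbb Q}\{\Downarrow s\mid s\in S'\}$; (v) $s_1+_{\mathbb V}s_2\xrightarrow{\ell}s'$ iff $s'=s_1'+_{\mathbb V}s_2'$ for some $s_1',s_2'$ with $s_1\xrightarrow{\ell}s_1'$ and $s_2\xrightarrow{\ell}s_2'$; $\Downarrow(s_1+_{\mathbb V}s_2)=\Downarrow s_1+_{\mathbb Q}\Downarrow s_2$. A relation $\mathcal{R}\subseteq S\times S$ is a $\le_{\mathbb Q}$-preserving simulation if $s_1\,\mathcal{R}\,s_2$ implies: $\Downarrow s_1\le_{\mathbb Q}\Downarrow s_2$; and for all $\ell$, if $s_2\xrightarrow{\ell}s_2'$ then there is $s_1'$ with $s_1\xrightarrow{\ell}s_1'$ and $s_1'\,\mathcal{R}\,s_2'$. $s$ is a lower (resp. upper) bound of $S'\subseteq S$ if $s\le_{\mathbb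 V}s'$ (resp. $s'\le_{\mathbb V}s$) for all $s'\in S'$. *)

(* Defs.v *)
From Corelib Require Export Relation_Definitions.
From mathcomp Require Export all_boot.
From mathcomp Require Export boolp classical_sets functions.

Set Implicit Arguments.
Unset Strict Implicit.
Unset Printing Implicit Defensive.

Local Open Scope classical_set_scope.

(* Bounds with respect to an arbitrary relation; classical_sets only has them
   for porderType, whereas here the relation may fail to be antisymmetric. *)
Definition lower_bound (T : Type) (R : relation T) (A : set T) (x : T) : Prop :=
  forall y, A y -> R x y.

Definition upper_bound (T : Type) (R : relation T) (A : set T) (x : T) : Prop :=
  forall y, A y -> R y x.

Definition is_inf (T : Type) (R : relation T) (A : set T) (x : T) : Prop :=
  lower_bound R A x /\ forall y, lower_bound R A y -> R y x.

Definition is_sup (T : Type) (R : relation T) (A : set T) (x : T) : Prop :=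
  upper_bound R A x /\ forall y, upper_bound R A y -> R x y.

Definition meet_le (T : Type) (meet : set T -> T) : relation T :=
  fun e f => e = meet [set e; f].

Record is_complete_lattice (T : Type) (meet join : set T -> T) (bot top : T) :
    Prop := {
  cl_order : Relation_Definitions.order T (meet_le meet);
  cl_meet : forall A : set T, is_inf (meet_le meet) A (meet A);
  cl_join : forall A : set T, is_sup (meet_le meet) A (join A);
  cl_bot : forall e, meet_le meet bot e;
  cl_top : forall e, meet_le meet e top }.

Record is_quantale (T : Type) (meet join : set T -> T) (bot top : T)
    (add : T -> T -> T) : Prop := {
  q_lattice : is_complete_lattice meet join bot top;
  q_addA : associative add;
  q_addC : commutative add;
  q_add0 : left_id bot add;
  q_add_meet : forall (e : T) (A : set T),
    add e (meet A) = meet [set add e f | f in A] }.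

Record quantale := Quantale {
  qsort :> Type;
  qmeet : set qsort -> qsort;
  qjoin : set qsort -> qsort;
  qbot : qsort;
  qtop : qsort;
  qadd : qsort -> qsort -> qsort;
  quantaleP : is_quantale qmeet qjoin qbot qtop qadd }.

Arguments qbot : clear implicits.
Arguments qtop : clear implicits.

Definition qle (Q : quantale) : relation Q := meet_le (@qmeet Q).

Record preMLTS (Q : quantale) := PreMLTS {
  state : Type;
  label : Type;
  step : state -> label -> state -> Prop;
  value : state -> Q }.

(* In vjoin_step, a surjection A ->> B is a total function on states
   that maps A onto B; its values outside A are irrelevant. *)
Record MLTS (Q : quantale) := MkMLTS {
  preMLTS_of :> preMLTS Q;
  vbot : state preMLTS_of;
  vtop : state preMLTS_of;
  vmeet : set (state preMLTS_of) -> state preMLTS_of;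
  vjoin : set (state preMLTS_of) -> state preMLTS_of;
  vadd : state preMLTS_of -> state preMLTS_of -> state preMLTS_of;
  vbot_step : forall l s, step vbot l s <-> s = vbot;
  vbot_value : value vbot = qbot Q;
  vtop_step : forall l s, ~ step vtop l s;
  vtop_value : value vtop = qtop Q;
  vmeet_step : forall (A : set (state preMLTS_of)) l s,
    step (vmeet A) l s <-> exists2 s', A s' & step s' l s;
  vmeet_value : forall A : set (state preMLTS_of),
    value (vmeet A) = qmeet [set value s | s in A];
  vjoin_step : forall (A : set (state preMLTS_of)) l s,
    step (vjoin A) l s <->
    exists B : set (state preMLTS_of), s = vjoin B /\
      exists f : state preMLTS_of -> state preMLTS_of,
        [/\ set_fun A B f, set_surj A B f &
            forall s', A s' -> step s' l (f s')];
  vjoin_value : forall A : set (state preMLTS_of),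
    value (vjoin A) = qjoin [set value s | s in A];
  vadd_step : forall s1 s2 l s',
    step (vadd s1 s2) l s' <->
    exists s1' s2', [/\ s' = vadd s1' s2', step s1 l s1' & step s2 l s2'];
  vadd_value : forall s1 s2,
    value (vadd s1 s2) = qadd (value s1) (value s2) }.

Arguments vbot {Q} _.
Arguments vtop {Q} _.

Definition is_simulation (Q : quantale) (V : preMLTS Q)
    (R : relation (state V)) : Prop :=
  forall s1 s2, R s1 s2 ->
    qle (value s1) (value s2) /\
    forall l s2', step s2 l s2' -> exists2 s1', step s1 l s1' & R s1' s2'.

Definition is_largest_simulation (Q : quantale) (V : preMLTS Q)
    (R : relation (state V)) : Prop :=
  is_simulation R /\
  forall R' : relation (state V), is_simulation R' -> inclusion _ R' R.

Lemma largest_simulation_exists (Q : quantale) (V : preMLTS Q) :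
  exists R : relation (state V), is_largest_simulation R.
Proof.
exists (fun s t => exists2 R : relation (state V), is_simulation R & R s t).
split=> [s1 s2 [R simR Rs]|R' simR' s t R'st]; last by exists R'.
have [le_s step_s] := simR _ _ Rs; split=> // l s2' /step_s[s1' st1 R1].
by exists s1' => //; exists R.
Qed.

Definition equiv_of (T : Type) (R : relation T) : relation T :=
  fun s t => R s t /\ R t s.

(* Main.v *)
(* Each (in)equality is proved by coinduction, exhibiting a simulation up to the
   largest one: the operators of a metric LTS commute with transitions, so the
   family of all instances of the inequality is closed under matching steps, and
   the conditions on values hold because they do in the quantale. When the
   preorder is antisymmetric, the equivalences become equalities, and the order
   defined by binary meets is the simulation order. *)
Require Import Defs.

Set Implicit Arguments.
Unset Strict Implicit.
Unset Printing Implicit Defensive.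

Local Open Scope classical_set_scope.

(** The union of [R] and [leV] is a simulation, so maximality of [leV] absorbs it. Matched
    successors may thus leave [R] as soon as they are known to lie in [leV]. *)
Lemma simulation_coind (Q : quantale) (V : preMLTS Q) (leV R : relation (state V)) :
  is_largest_simulation leV ->
  (forall s t, R s t -> qle (value s) (value t) /\
    forall l t', step t l t' -> exists2 s', step s l s' & R s' t' \/ leV s' t') ->
  inclusion _ R leV.
Proof.
move=> [simV maxV] simR s t Rst.
apply: (maxV (fun s t => R s t \/ leV s t)); last by left.
move=> {Rst} {}s {}t [/simR//|/simV[les steps]].
by split=> // l t' /steps[s' ss' le']; exists s' => //; right.
Qed.

Section QuantaleOrder.
Variable Q : quantale.

Let latQ := q_lattice (quantaleP Q).

Lemma qle_refl (e : Q) : qle e e.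
Proof. exact: (Relation_Definitions.ord_refl _ _ (cl_order latQ)). Qed.

Lemma qle_trans (e f g : Q) : qle e f -> qle f g -> qle e g.
Proof. exact: (Relation_Definitions.ord_trans _ _ (cl_order latQ)). Qed.

End QuantaleOrder.

Section LargestSimulation.
Variables (Q : quantale) (V : preMLTS Q) (leV : relation (state V)).
Hypothesis leV_largest : is_largest_simulation leV.

Lemma leV_refl (s : state V) : leV s s.
Proof.
apply: (simulation_coind (R := eq) leV_largest) => // {}s _ <-.
by split=> [|l t' st']; [exact: qle_refl | exists t' => //; left].
Qed.

Lemma leV_trans (s t u : state V) : leV s t -> leV t u -> leV s u.
Proof.
move=> st tu; have [simV _] := leV_largest.
apply: (simulation_coind (R := fun s u => exists2 t, leV s t & leV t u)
  leV_largest); last by exists t.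
move=> {s t u st tu} s u [t /simV[lest stepst] /simV[letu steptu]].
split=> [|l u' /steptu[t' /stepst[s' ss' st'] tu']]; first exact: qle_trans letu.
by exists s' => //; left; exists t'.
Qed.

(** Each step of [t] is answered by [s] with the very same target, and reflexivity relates the
    target to itself; no invariant has to be carried along. *)
Lemma leV_same_steps (s t : state V) :
  qle (value s) (value t) -> (forall l u, step t l u -> step s l u) -> leV s t.
Proof.
move=> lest stepst.
apply: (simulation_coind (R := fun s' t' => s' = s /\ t' = t) leV_largest) => //.
move=> _ _ [-> ->]; split=> // l u /stepst su.
by exists u => //; right; apply: leV_refl.
Qed.

End LargestSimulation.

Section MetricLTS.
Variables (Q : quantale) (V : MLTS Q) (leV : relation (state V)).
Hypothesis leV_largest : is_largest_simulation leV.

Let quaQ := quantaleP Q.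
Let latQ := q_lattice quaQ.

Lemma leV_bot (s : state V) : leV (vbot V) s.
Proof.
(* [vbot] loops on every label, so it answers any step by staying in place, whatever the other state
   becomes. *)
apply: (simulation_coind (R := fun b _ => b = vbot V) leV_largest) => // _ t ->.
split=> [|l t' _]; first by rewrite vbot_value; apply: (cl_bot latQ).
by exists (vbot V); [apply/vbot_step | left].
Qed.

Lemma leV_top (s : state V) : leV s (vtop V).
Proof.
apply: (leV_same_steps leV_largest) => [|l u /vtop_step//].
by rewrite vtop_value; apply: (cl_top latQ).
Qed.

Lemma vmeet_is_inf (A : set (state V)) : is_inf leV A (vmeet A).
Proof.
have [simV _] := leV_largest; split=> [s As | s lbs].
  apply: (leV_same_steps leV_largest) => [|l u su].
    by rewrite vmeet_value; apply: (proj1 (cl_meet latQ _)); exists s.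
  by apply/vmeet_step; exists s.
apply: (simulation_coind (R := fun s m => m = vmeet A /\ lower_bound leV A s)
  leV_largest) => //.
move=> {lbs} {}s _ [-> lbs]; split=> [|l u /vmeet_step[a Aa au]].
  rewrite vmeet_value; apply: (proj2 (cl_meet latQ _)) => _ [a Aa <-].
  by case: (simV _ _ (lbs _ Aa)).
(* The step of the meet is a step of its member [a], and [s] lies below [a]: the answer lands
   directly in [leV]. *)
have [_ /(_ _ _ au)[s' ss' les']] := simV _ _ (lbs _ Aa).
by exists s' => //; right.
Qed.

Lemma vjoin_is_sup (A : set (state V)) : is_sup leV A (vjoin A).
Proof.
have [simV _] := leV_largest; split=> [s As | s ubs].
  (* The set is quantified inside the relation because a step from [vjoin A] leads to the join of
     another set [B], which contains the matching successor [f s]. *)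
  apply: (simulation_coind (R := fun s j => exists2 A, A s & j = vjoin A)
    leV_largest); last by exists A.
  move=> {A As} {}s _ [A As ->]; split=> [|l _ /vjoin_step[B [-> [f [AB _ fstep]]]]].
    by rewrite vjoin_value; apply: (proj1 (cl_join latQ _)); exists s.
  by exists (f s); [exact: fstep | left; exists B => //; exact: AB].
apply: (simulation_coind
  (R := fun j s => exists2 A, upper_bound leV A s & j = vjoin A)
  leV_largest); last by exists A.
move=> {A ubs} _ {}s [A ubs ->]; split=> [|l u su].
  rewrite vjoin_value; apply: (proj2 (cl_join latQ _)) => _ [a Aa <-].
  by case: (simV _ _ (ubs _ Aa)).
(* Every member of [A] picks an answer to the step towards [u]; outside [A] the value [a] is only a
   default making [f] total. *)
have /choice[f fP] (a : state V) : exists a', A a -> step a l a' /\ leV a' u.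
  have [Aa|nAa] := pselect (A a); last by exists a.
  by have [_ /(_ _ _ su)[a' aa' le']] := simV _ _ (ubs _ Aa); exists a'.
(* Taking the image of [A] makes [f] surjective by construction, and [u] is an upper bound of that
   image. *)
exists (vjoin (f @` A)).
  apply/vjoin_step; exists (f @` A); split=> //; exists f.
  by split=> [a Aa|b|a /fP[]//]; first by exists a.
by left; exists (f @` A) => // _ [a /fP[_ le] <-].
Qed.

(** Both sides have the same transitions, and distributivity in [Q] gives them the same value. *)
Lemma vadd_vmeet (s : state V) (A : set (state V)) :
  equiv_of leV (vadd s (vmeet A)) (vmeet [set vadd s s' | s' in A]).
Proof.
have valE : value (vadd s (vmeet A)) = value (vmeet [set vadd s s' | s' in A]).
  rewrite vadd_value !vmeet_value (q_add_meet quaQ) !image_comp.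
  by congr (qmeet _); apply: eq_imagel => a _ /=; rewrite vadd_value.
split; apply: (leV_same_steps leV_largest); rewrite ?valE; try exact: qle_refl.
  move=> l _ /vmeet_step[_ [a Aa <-] /vadd_step[s1 [a1 [-> ss1 aa1]]]].
  by apply/vadd_step; exists s1, a1; split=> //; apply/vmeet_step; exists a.
move=> l _ /vadd_step[s1 [a1 [-> ss1 /vmeet_step[a Aa aa1]]]].
apply/vmeet_step; exists (vadd s a); first by exists a.
by apply/vadd_step; exists s1, a1.
Qed.

(** The only successor of [vbot] is itself, so the shape of the sum survives every step. *)
Lemma vadd_bot (s : state V) : equiv_of leV (vadd s (vbot V)) s.
Proof.
have valE (t : state V) : value (vadd t (vbot V)) = value t.
  by rewrite vadd_value vbot_value (q_addC quaQ) (q_add0 quaQ).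
split.
  apply: (simulation_coind (R := fun s t => s = vadd t (vbot V)) leV_largest) => //.
  move=> _ {}s ->; rewrite valE; split=> [|l t st]; first exact: qle_refl.
  exists (vadd t (vbot V)); last by left.
  by apply/vadd_step; exists t, (vbot V); split=> //; apply/vbot_step.
apply: (simulation_coind (R := fun s t => t = vadd s (vbot V)) leV_largest) => //.
move=> {}s _ ->; rewrite valE; split=> [|l _ /vadd_step[s' [b [-> ss' /vbot_step ->]]]].
  exact: qle_refl.
by exists s' => //; left.
Qed.

Lemma leV_vaddC (s t : state V) : leV (vadd s t) (vadd t s).
Proof.
apply: (simulation_coind
  (R := fun x y => exists s t, x = vadd s t /\ y = vadd t s) leV_largest);
  last by exists s, t.
move=> {s t} _ _ [s [t [-> ->]]].
split=> [|l _ /vadd_step[t' [s' [-> tt' ss']]]].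
  by rewrite !vadd_value (q_addC quaQ); exact: qle_refl.
by exists (vadd s' t'); [apply/vadd_step; exists s', t' | left; exists s', t'].
Qed.

Lemma vaddAC (s t u : state V) :
  equiv_of leV (vadd (vadd s t) u) (vadd t (vadd s u)).
Proof.
have valE (x y z : state V) :
    value (vadd (vadd x y) z) = value (vadd y (vadd x z)).
  by rewrite !vadd_value (q_addA quaQ) (q_addC quaQ (value x)).
split.
  apply: (simulation_coind (R := fun a b => exists x y z,
    a = vadd (vadd x y) z /\ b = vadd y (vadd x z)) leV_largest);
    last by exists s, t, u.
  move=> _ _ [x [y [z [-> ->]]]]; rewrite valE.
  split=> [|l _ /vadd_step[y' [_ [-> yy' /vadd_step[x' [z' [-> xx' zz']]]]]]].
    exact: qle_refl.
  exists (vadd (vadd x' y') z'); last by left; exists x', y', z'.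
  by apply/vadd_step; exists (vadd x' y'), z'; split=> //; apply/vadd_step; exists x', y'.
apply: (simulation_coind (R := fun b a => exists x y z,
  a = vadd (vadd x y) z /\ b = vadd y (vadd x z)) leV_largest);
  last by exists s, t, u.
move=> _ _ [x [y [z [-> ->]]]]; rewrite valE.
split=> [|l _ /vadd_step[_ [z' [-> /vadd_step[x' [y' [-> xx' yy']]] zz']]]].
  exact: qle_refl.
exists (vadd y' (vadd x' z')); last by left; exists x', y', z'.
by apply/vadd_step; exists y', (vadd x' z'); split=> //; apply/vadd_step; exists x', z'.
Qed.

(** If [e] is below [f], then [e] is itself a greatest lower bound of the pair, and antisymmetry
    identifies it with the meet. This transfers the bounds proved for [leV] to the order that a
    quantale derives from its meet. *)
Lemma meet_le_vmeetE :
  Relation_Definitions.order _ leV -> meet_le (@vmeet Q V) = leV.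
Proof.
move=> [_ _ anti]; apply/funext => e; apply/funext => f; apply/propext.
have [lb glb] := vmeet_is_inf [set e; f]; split=> [ -> | ef].
  by apply: lb; right.
apply: anti; last by apply: lb; left.
by apply: glb => _ [->|->] //; apply: (leV_refl leV_largest).
Qed.

Lemma antisymmetric_MLTS_is_quantale :
  Relation_Definitions.order _ leV ->
  is_quantale (@vmeet Q V) (@vjoin Q V) (vbot V) (vtop V) (@vadd Q V).
Proof.
move=> ordV; have [_ _ anti] := ordV.
have eqV s t : equiv_of leV s t -> s = t by case; apply: anti.
have addC : commutative (@vadd Q V).
  by move=> s t; apply: eqV; split; apply: leV_vaddC.
split=> //; last by move=> s A; apply: eqV; apply: vadd_vmeet.
- split; rewrite meet_le_vmeetE //.
  + exact: vmeet_is_inf.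
  + exact: vjoin_is_sup.
  + exact: leV_bot.
  + exact: leV_top.
(* Swapping the first two summands turns associativity into an instance of [vaddAC]. *)
- by move=> s t u; rewrite (addC s t); apply/esym/eqV/vaddAC.
- by move=> s; rewrite addC; apply: eqV; apply: vadd_bot.
Qed.

End MetricLTS.

Theorem proposition3p7 (Q : quantale) (V : MLTS Q)
    (leV : relation (state V)) (leV_largest : is_largest_simulation leV) :
  Relation_Definitions.preorder (state V) leV /\
  (forall s : state V, leV (vbot V) s /\ leV s (vtop V)) /\
  (forall A : set (state V),
     lower_bound leV A (vmeet A) /\
     forall s', lower_bound leV A s' -> leV s' (vmeet A)) /\
  (forall A : set (state V),
     upper_bound leV A (vjoin A) /\
     forall s', upper_bound leV A s' -> leV (vjoin A) s') /\
  (forall (s : state V) (A : set (state V)),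
     equiv_of leV (vadd s (vmeet A)) (vmeet [set vadd s s' | s' in A])) /\
  (forall s : state V, equiv_of leV (vadd s (vbot V)) s) /\
  (forall s s' : state V, equiv_of leV (vadd s s') (vadd s' s)) /\
  (forall s s' s'' : state V,
     equiv_of leV (vadd (vadd s s') s'') (vadd s' (vadd s s''))) /\
  (Relation_Definitions.order (state V) leV ->
     is_quantale (@vmeet Q V) (@vjoin Q V) (vbot V) (vtop V) (@vadd Q V)).
Proof.
split; first by split; [exact: leV_refl | exact: leV_trans].
split; first by move=> s; split; [exact: leV_bot | exact: leV_top].
split; first exact: vmeet_is_inf.
split; first exact: vjoin_is_sup.
split; first exact: vadd_vmeet.
split; first exact: vadd_bot.
split; first by move=> s t; split; apply: leV_vaddC.
split; first exact: vaddAC.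
exact: antisymmetric_MLTS_is_quantale.
Qed.
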